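(* Let $n\ge1$, $0\le p\le n$ and $k\ge1$ be integers, and let $\omega\in Q_k^p(\square^n)$. If $\int_{\upsilon}\omega=0$ for all $k$th order small $p$-cubes $\upsilon\in S_k^p(\square^n)$, then $\omega=0$.
   Context: $\square^n=[0,1]^n$ is the unit $n$-cube. $\mathcal{J}(n,k-1)$ is the set of multi-indices $\mathbf{k}=(k_1,\ldots,k_n)$ of integers with $0\le k_i\le k-1$. Each $\mathbf{k}\in\mathcal{J}(n,k-1)$ defines a map $\mathbf{k}_{k-1}:\square^n\to\square^n$, $\mathbf{k}_{k-1}(x_1,\ldots,x_n)=\frac{1}{k}(k_1+x_1,\ldots,k_n+x_n)$. The set of $k$th order small $p$-cubes of $\square^n$ is $S_k^p(\square^n)=\{\mathbf{k}_{k-1}(\tau)\mid \mathbf{k}\in\mathcal{J}(n,k-1),\ \tau \text{ a } p\text{-face of } \square^n\}$. (Small cubes are given arbitrary orientations when integrating; for $p=0$ the integral of a function over a point is its value.) Let $\tau$ be a $p$-face of $\square^n$, let $x_{i_1},\ldots,x_{i_p}$ ($i_1<\ldots<i_p$) be the coordinates whose plane is parallel to $\tau$, and let $x_{i_{p+1}},\ldots,x_{i_n}$ be the other coordinates, which have constant values $y_{i_{p+1}},\ldots,y_{i_n}\in\{0,1\}$ on $\tau$. The lowest order cubical form of $\tau$ is $$\mathcal{W}\tau=\Big(\prod_{j=p+1}^n x_{i_j}^{y_{i_j}}(1-x_{i_j})^{1-y_{i_j}}\Big)\,\mathrm{d}x_{i_1}\wedge\ldots\wedge \mathrm{d}x_{i_p}.$$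 The $k$th order cubical $p$-form corresponding to the small cube $\mathbf{k}_{k-1}(\tau)$ is $$w(\mathbf{k}_{k-1}(\tau))=\Big(\prod_{i=1}^n x_i^{k_i}(1-x_i)^{k-1-k_i}\Big)\mathcal{W}\tau,$$ and $Q_k^p(\square^n)$ is the real linear span of $w(\mathbf{k}_{k-1}(\tau))$ over all $\mathbf{k}\in\mathcal{J}(n,k-1)$ and all $p$-faces $\tau$ of $\square^n$. Zeroth powers are $1$ (so $0^0=1$). *)

(* Defs.v *)
From mathcomp Require Import all_boot all_order all_algebra.
From mathcomp Require Import all_classical all_reals all_analysis.
Set Implicit Arguments.
Unset Strict Implicit.
Unset Printing Implicit Defensive.
Import Order.TTheory GRing.Theory Num.Theory.
Import numFieldNormedType.Exports.
Local Open Scope classical_set_scope.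
Local Open Scope ring_scope.

Definition unit_cube (R : realType) (n : nat) : set 'rV[R]_n :=
  [set x | forall i, 0 <= x 0 i <= 1].

(* A p-form sends a point x and p tangent vectors (the rows of V) to a number.
   A form on the unit cube is represented by a form on R^n of which only the
   values at points of the cube are ever used; in particular forms on the cube
   are compared at the points of the cube only. *)
Definition diff_form (R : realType) (n p : nat) := 'rV[R]_n -> 'M[R]_(p, n) -> R.

(* dx_(c 0) /\ ... /\ dx_(c (p-1)), with the normalization under which it takes
   the value 1 on the basis vectors e_(c 0), ..., e_(c (p-1)) when these are
   distinct. *)
Definition dx_wedge (R : realType) (n p : nat) (c : 'I_p -> 'I_n) : diff_form R n p :=
  fun _ V => \det (colsub c V).

(* A face of the n-cube is coded by a function on the coordinates: None for a
   coordinate that varies on the face, Some b for one with constant value b. *)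
Definition free_coords (n : nat) (t : {ffun 'I_n -> option bool}) : {set 'I_n} :=
  [set i | t i == None]%SET.

Definition face (n p : nat) : Type :=
  {t : {ffun 'I_n -> option bool} | #|free_coords t| == p}.

Section Faces.
Variables (R : realType) (n p : nat) (t : face n p).

(* i_1 < ... < i_p: enum_val enumerates a set of ordinals increasingly. *)
Definition face_coord (j : 'I_p) : 'I_n :=
  enum_val (cast_ord (esym (eqP (valP t))) j).

(* The constant value y_i when i is not free (and 0, unused, otherwise). *)
Definition face_value (i : 'I_n) : nat := val t i == Some true.

(* Affine parametrization of the face by the unit p-cube. *)
Definition face_param (s : 'rV[R]_p) : 'rV[R]_n :=
  (\row_i (face_value i)%:R) + \sum_j s 0 j *: delta_mx 0 (face_coord j).

Definition lowest_form : diff_form R n p := fun x V =>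
  (\prod_(i | i \notin free_coords (val t))
     (x 0 i ^+ face_value i * (1 - x 0 i) ^+ (1 - face_value i)))
  * dx_wedge face_coord x V.

End Faces.

(* 'I_k is {0, ..., k-1}. *)
Definition multi_index (n k : nat) := {ffun 'I_n -> 'I_k}.

Definition shrink (R : realType) (n k : nat) (m : multi_index n k)
    (x : 'rV[R]_n) : 'rV[R]_n :=
  \row_i (k%:R^-1 * ((m i)%:R + x 0 i)).

(* Each small cube is given as its affine parametrization by the unit p-cube,
   oriented by the increasing order of its p free coordinates. The opposite
   orientation changes only the sign of an integral. *)
Definition small_cube (R : realType) (n p k : nat) (m : multi_index n k)
    (t : face n p) : 'rV[R]_p -> 'rV[R]_n :=
  fun s => shrink m (face_param t s).

Definition small_cubes (R : realType) (n p k : nat) : set ('rV[R]_p -> 'rV[R]_n) :=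
  [set u | exists (m : multi_index n k) (t : face n p), u = small_cube m t].

Definition cubical_form (R : realType) (n p k : nat) (m : multi_index n k)
    (t : face n p) : diff_form R n p := fun x V =>
  (\prod_i (x 0 i ^+ m i * (1 - x 0 i) ^+ (k - 1 - m i))) * lowest_form t x V.

Definition cubical_space (R : realType) (n p k : nat) : set (diff_form R n p) :=
  [set w | exists a : multi_index n k -> face n p -> R,
     forall x, unit_cube x -> forall V,
       w x V = \sum_m \sum_t a m t * cubical_form m t x V].

(* Integral over the unit p-cube, as an iterated integral; for p = 0 it is the
   value at the point. *)
Fixpoint integral_unit_cube (R : realType) (p : nat) : ('rV[R]_p -> R) -> R :=
  match p with
  | 0 => fun f => f 0
  | q.+1 => fun f =>
      \int[lebesgue_measure]_(s in `[0, 1])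
        integral_unit_cube (fun r : 'rV[R]_q => f (row_mx s%:M r))
  end.

(* The integral of w over a parametrized p-cube u is that of its pullback: the
   rows of the Jacobian matrix of u are its partial derivatives. *)
Definition integral_form (R : realType) (n p : nat) (u : 'rV[R]_p -> 'rV[R]_n)
    (w : diff_form R n p) : R :=
  integral_unit_cube (fun s => w (u s) (jacobian u s)).

(* Main.v *)
Require Import Defs.
From HB Require Import structures.
From mathcomp Require Import all_boot all_order all_algebra.
From mathcomp Require Import all_classical all_reals all_analysis.
Import Order.TTheory GRing.Theory Num.Theory.
Import numFieldNormedType.Exports.
Local Open Scope classical_set_scope.
Local Open Scope ring_scope.

(** Fix a set [F] of [p] coordinates.  The coefficient of [dx_F] in a form of
    order [k] is a linear combination of products of univariate polynomials,
    one for each coordinate, of degree at most [k - 1] in the coordinates of [F]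
    and at most [k] in the others.  On a small cube parallel to [F] only this
    coefficient contributes to the integral, and the integral of a product of
    univariate polynomials is a product of univariate functionals: in a
    coordinate of [F], the mean over one of the [k] cells
    [[j / k, (j + 1) / k]]; in any other coordinate, the value at one of the
    [k + 1] grid points [j / k].  (The integral over the small cube is [k ^- p]
    times this product.)

    In one variable each family of functionals determines the polynomial
    ([cell_functional_inj]).  For values at the grid points this is the bound on
    the number of roots; for means over the cells, an antiderivative has degree
    at most [k] and takes the same value at all grid points, so it is constant.
    Injectivity turns into a quadrature formula: the value of the polynomial at
    any point is a fixed linear combination of the functionals ([quadrature]).

    Multiplying the quadrature formulas of all the coordinates writes the value
    of the coefficient of [dx_F] at any point as a linear combination of the
    products of functionals, that is, of integrals over small cubes parallel to
    [F] ([tensor_unisolvence], [integral_small_cube]).  These vanish, so every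
    coefficient of the form vanishes. *)

(** * Integration of polynomials over the unit interval *)

(** The antiderivative that vanishes at [0]: the summand at [i = 0] has the
    factor [0%:R^-1 = 0]. *)
Definition antideriv {F : fieldType} (p : {poly F}) : {poly F} :=
  \poly_(i < (size p).+1) (p`_i.-1 / i%:R).

Lemma coef_antideriv {F : fieldType} (p : {poly F}) i :
  (antideriv p)`_i = p`_i.-1 / i%:R.
Proof.
rewrite coef_poly; case: i => [|i]; first by rewrite invr0 !mulr0.
rewrite ltnS /=; case: ltnP => // le_p_i.
by rewrite (nth_default 0 le_p_i) mul0r.
Qed.

Lemma antideriv_is_scalable {F : fieldType} : scalable (@antideriv F).
Proof.
by move=> a p; apply/polyP => i; rewrite coefZ !coef_antideriv coefZ mulrA.
Qed.

Lemma antideriv_is_additive {F : fieldType} : additive (@antideriv F).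
Proof.
move=> p q; apply/polyP => i.
by rewrite coefB !coef_antideriv coefB mulrBl.
Qed.

HB.instance Definition _ (F : fieldType) :=
  GRing.isZmodMorphism.Build {poly F} {poly F} antideriv antideriv_is_additive.
HB.instance Definition _ (F : fieldType) :=
  GRing.isScalable.Build F {poly F} {poly F} *:%R antideriv
    antideriv_is_scalable.

Definition poly_integral01 {F : fieldType} (p : {poly F}) : F :=
  (antideriv p).[1].

Lemma poly_integral01_is_linear {F : fieldType} :
  linear_for *%R (@poly_integral01 F).
Proof.
by move=> a p q; rewrite /poly_integral01 linearP hornerD hornerZ.
Qed.

HB.instance Definition _ (F : fieldType) :=
  GRing.isLinear.Build F {poly F} F *%R poly_integral01
    poly_integral01_is_linear.

Lemma deriv_antideriv {F : numFieldType} (p : {poly F}) : (antideriv p)^`() = p.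
Proof.
apply/polyP => i; rewrite coef_deriv coef_antideriv /=.
by rewrite -[LHS]mulr_natr mulfVK // pnatr_eq0.
Qed.

Lemma poly_integral01_deriv {F : numFieldType} (p : {poly F}) :
  poly_integral01 p^`() = p.[1] - p.[0].
Proof.
rewrite /poly_integral01; have -> : antideriv p^`() = p - (p`_0)%:P.
  apply/polyP => -[|i]; rewrite coef_antideriv coefB coefC /=.
    by rewrite invr0 mulr0 subrr.
  by rewrite coef_deriv subr0 -[_ *+ i.+1]mulr_natr mulfK // pnatr_eq0.
by rewrite hornerD hornerN hornerC horner_coef0.
Qed.

Lemma Rintegral01_horner {R : realType} (p : {poly R}) :
  \int[lebesgue_measure]_(s in `[0, 1]) p.[s] = poly_integral01 p.
Proof.
have E : (antideriv p).[0] = 0.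
  by rewrite horner_coef0 coef_antideriv invr0 mulr0.
rewrite /Rintegral (@continuous_FTC2 _ _ (horner (antideriv p))) //.
- by rewrite E -EFinD subr0.
- by apply/continuous_subspaceT => x; exact: continuous_horner.
- split=> [x _| |].
  + exact: derivable_horner.
  + by apply: cvg_at_right_filter; exact: continuous_horner.
  + by apply: cvg_at_left_filter; exact: continuous_horner.
- by move=> x _; rewrite -derivE deriv_antideriv.
Qed.

(** * Iterated integrals over the unit cube *)

Lemma eq_integral_unit_cube {R : realType} p (f g : 'rV[R]_p -> R) :
  (forall s, unit_cube s -> f s = g s) ->
  integral_unit_cube f = integral_unit_cube g.
Proof.
elim: p f g => [|p IHp] f g fg /=; first by apply: fg => -[].
apply: eq_Rintegral => s; rewrite inE /= in_itv /= => s01.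
apply: IHp => r r01; apply: fg => i; rewrite mxE.
by case: fintype.split => j; [rewrite ord1 mxE | exact: r01].
Qed.

(** Fubini for polynomials in split form.  Since the inner integral is again a
    polynomial in the outer variable, the fundamental theorem of calculus is
    the only fact about the Lebesgue integral involved. *)
Lemma integral_unit_cube_sum {R : realType} p (K : finType) (c : K -> R)
    (q : K -> 'I_p -> {poly R}) :
  integral_unit_cube (fun s => \sum_a c a * \prod_j (q a j).[s 0 j]) =
  \sum_a c a * \prod_j poly_integral01 (q a j).
Proof.
elim: p c q => [|p IHp] c q /=.
  by apply: eq_bigr => a _; rewrite !big_ord0.
transitivity (\int[lebesgue_measure]_(s in `[0, 1])
   (\sum_a (c a * \prod_j poly_integral01 (q a (lift ord0 j))) *:
       q a ord0).[s]).
  apply: eq_Rintegral => s _.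
  transitivity (integral_unit_cube (fun r : 'rV_p => \sum_a
     (c a * (q a ord0).[s]) * \prod_j (q a (lift ord0 j)).[r 0 j])).
    apply: eq_integral_unit_cube => r _; apply: eq_bigr => a _.
    rewrite big_ord_recl -mulrA mxE; congr (_ * (_.[_] * _)).
      by case: fintype.splitP => j //; rewrite ord1 mxE mulr1n.
    apply: eq_bigr => j _; congr _.[_]; rewrite mxE.
    case: fintype.splitP => l; first by rewrite ord1.
    by case=> jl; congr (r _ _); exact: val_inj.
  rewrite IHp horner_sum; apply: eq_bigr => a _.
  by rewrite hornerZ mulrAC.
rewrite Rintegral01_horner raddf_sum; apply: eq_bigr => a _.
by rewrite /= linearZ /= big_ord_recl mulrAC mulrA.
Qed.

(** * From unisolvence in one variable to products *)

(** A family of functionals that separates the polynomials of size at most [d]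
    spans their dual, so that it expresses the evaluation at [x].  In matrix
    terms, the matrix of the functionals in the monomial basis has
    independent rows, hence a right inverse. *)
Lemma quadrature {F : fieldType} (d : nat) (J : finType)
    (L : J -> {scalar {poly F}}) (x : F) :
  (forall p : {poly F}, (size p <= d)%N -> (forall j, L j p = 0) -> p = 0) ->
  exists B : J -> F, forall p : {poly F}, (size p <= d)%N ->
    p.[x] = \sum_j B j * L j p.
Proof.
move=> L_inj.
pose A := \matrix_(l < d, j < #|J|) L (enum_val j) 'X^l.
(* [A] represents the functionals on coordinate vectors of polynomials. *)
have AE (p : {poly F}) j :
    (size p <= d)%N -> (poly_rV p *m A) 0 j = L (enum_val j) p.
  move=> sp; rewrite mxE -[p in RHS](poly_rV_K sp) /rVpoly poly_def.
  rewrite raddf_sum; apply: eq_bigr => l _; rewrite !mxE valK.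
  by rewrite /= linearZ /= mxE.
have /row_freeP[D AD1] : row_free A.
  apply: inj_row_free => v vA0; rewrite -[v]rVpolyK.
  have -> : rVpoly v = 0; last by rewrite raddf0.
  apply: L_inj => [|j]; first exact: size_poly.
  by rewrite -[j]enum_rankK -AE ?size_poly // rVpolyK vA0 mxE.
pose X : 'cV_d := \col_l x ^+ l.
exists (fun j => (D *m X) (enum_rank j) 0) => p sp.
have -> : p.[x] = (poly_rV p *m A *m (D *m X)) 0 0.
  rewrite mulmxA -(mulmxA _ A) AD1 mulmx1 mxE (horner_coef_wide _ sp).
  by apply: eq_bigr => l _; rewrite !mxE.
rewrite mxE (reindex (@enum_rank J)) /=; last first.
  by apply: onW_bij; exact: enum_rank_bij.
by apply: eq_bigr => j _; rewrite AE // enum_rankK mulrC.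
Qed.

(** Tensor products inherit unisolvence: the product over [i] of the quadrature
    formulas for the evaluations at [x i] is a quadrature formula for products
    of polynomials, whose functionals are the products of the [L i (q i)].
    The condition [P] selects the terms of the combination that belong to one
    and the same coefficient of a form. *)
Lemma tensor_unisolvence {F : fieldType} (I J K : finType) (d : I -> nat)
    (L : I -> J -> {scalar {poly F}}) (P : pred K) (c : K -> F)
    (g : K -> I -> {poly F}) :
  (forall i (p : {poly F}), (size p <= d i)%N ->
     (forall j, L i j p = 0) -> p = 0) ->
  (forall a i, P a -> (size (g a i) <= d i)%N) ->
  (forall q : {ffun I -> J},
     \sum_(a | P a) c a * \prod_i L i (q i) (g a i) = 0) ->
  forall x : I -> F, \sum_(a | P a) c a * \prod_i (g a i).[x i] = 0.
Proof.
move=> L_inj sg L0 x.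
have /fin_all_exists[B BE] i := quadrature _ _ _ (x i) (L_inj i).
transitivity (\sum_(q : {ffun I -> J}) (\prod_i B i (q i)) *
    \sum_(a | P a) c a * \prod_i L i (q i) (g a i)); last first.
  by rewrite big1 // => q _; rewrite L0 mulr0.
under [RHS]eq_bigr do rewrite mulr_sumr.
rewrite exchange_big /=; apply: eq_bigr => a Pa.
under eq_bigr => i _ do rewrite (BE _ _ (sg _ _ Pa)).
rewrite bigA_distr_bigA mulr_sumr; apply: eq_bigr => q _.
by rewrite big_split /= mulrCA.
Qed.

(** * Functionals attached to the cells of the subdivided interval *)

Definition cell_line {F : fieldType} (k j : nat) : {poly F} :=
  (k%:R^-1)%:P * (j%:R%:P + 'X).

(** The contribution of one coordinate to the integral over a small cube: a mean
    over the cell [[j / k, (j + 1) / k]] when the coordinate varies on the cube,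
    the value at an end of the cell otherwise.  Each interior grid point occurs
    twice, as the right end of one cell and the left end of the next, and each
    mean occurs for both values of the boolean; this redundancy gives all
    coordinates the same index type. *)
Definition cell_functional {F : fieldType} (k : nat) (free : bool)
    (jb : 'I_k * bool) (p : {poly F}) : F :=
  if free then poly_integral01 (p \Po cell_line k jb.1)
  else (p \Po cell_line k jb.1).[jb.2%:R].

Lemma cell_functional_is_linear {F : fieldType} k free jb :
  linear_for *%R (@cell_functional F k free jb).
Proof.
move=> a p q; rewrite /cell_functional.
by case: free; rewrite comp_polyD comp_polyZ ?hornerD ?hornerZ // linearP.
Qed.

HB.instance Definition _ (F : fieldType) k free jb :=
  GRing.isLinear.Build F {poly F} F *%R (cell_functional k free jb)
    (cell_functional_is_linear k free jb).

Lemma horner_cell_line {F : fieldType} k j (x : F) :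
  (cell_line k j).[x] = k%:R^-1 * (j%:R + x).
Proof. by rewrite /cell_line !hornerE. Qed.

Lemma deriv_cell_line {F : fieldType} k j :
  (cell_line k j)^`() = (k%:R^-1 : F)%:P.
Proof.
by rewrite /cell_line mul_polyC derivZ derivD derivC derivX add0r alg_polyC.
Qed.

Lemma poly_eq0_grid {F : numFieldType} k (p : {poly F}) : (0 < k)%N ->
  (size p <= k.+1)%N ->
  (forall j, (j <= k)%N -> p.[k%:R^-1 * j%:R] = 0) -> p = 0.
Proof.
move=> k_gt0 sp p0.
apply: (@roots_geq_poly_eq0 _ p [seq k%:R^-1 * j%:R | j <- iota 0 k.+1]).
- apply/allP => _ /mapP[j jk ->]; move: jk; rewrite mem_iota ltnS => /= jk.
  by rewrite rootE p0.
- rewrite map_inj_uniq ?iota_uniq // => i j /mulfI e; apply/eqP; move: e.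
  by rewrite invr_eq0 pnatr_eq0 -lt0n => /(_ k_gt0) /eqP; rewrite eqr_nat.
- by rewrite size_map size_iota.
Qed.

(** By substitution, the mean over a cell is [k] times the increment over that
    cell of the antiderivative [P]; as [P] vanishes at [0], it vanishes at all
    the grid points [0, 1 / k, ..., 1] as soon as all the means vanish, while
    its degree is at most [k]. *)
Lemma cell_functional_inj {F : numFieldType} k free (p : {poly F}) :
  (0 < k)%N -> (size p <= (if free then k else k.+1))%N ->
  (forall jb : 'I_k * bool, cell_functional k free jb p = 0) -> p = 0.
Proof.
rewrite /cell_functional => k_gt0; case: free => sp L0; last first.
  apply: (poly_eq0_grid _ _ k_gt0 sp) => j; rewrite leq_eqVlt.
  case/predU1P => [->|jk].
    (* The grid point [1] is only the right end of the last cell. *)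
    have lt_k : (k.-1 < k)%N by rewrite prednK.
    have := L0 (Ordinal lt_k, true).
    by rewrite horner_comp horner_cell_line natr1 prednK.
  have := L0 (Ordinal jk, false).
  by rewrite horner_comp horner_cell_line addr0.
have dP : (antideriv p)^`() = p := deriv_antideriv p.
suff P0 : antideriv p = 0 by rewrite -dP P0 deriv0.
apply: (poly_eq0_grid _ _ k_gt0).
  by apply: leq_trans (size_poly _ _) _; rewrite ltnS.
elim=> [_|j IHj jk].
  by rewrite mulr0 horner_coef0 coef_antideriv invr0 mulr0.
have := poly_integral01_deriv (antideriv p \Po cell_line k j).
rewrite deriv_comp dP deriv_cell_line mulrC mul_polyC linearZ /=.
rewrite (L0 (Ordinal jk, false)) mulr0.
by rewrite !horner_comp !horner_cell_line addr0 natr1 IHj ?subr0 // ltnW.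
Qed.

(** * The univariate factors of a cubical form *)

(** The factor at one coordinate of the form attached to a small cube, where [o]
    is the code of that coordinate in the face: there is the extra factor [X] or
    [1 - X] exactly when the coordinate is constant on the face. *)
Definition cell_poly {F : fieldType} (k j : nat) (o : option bool) : {poly F} :=
  'X^j * (1 - 'X) ^+ (k - 1 - j) *
  (if o is Some b then 'X^b * (1 - 'X) ^+ (1 - b) else 1).

Lemma size_bernstein {F : fieldType} a b :
  (size ('X^a * (1 - 'X) ^+ b : {poly F})%R <= (a + b).+1)%N.
Proof.
apply: leq_trans (size_polyMleq _ _) _; rewrite size_polyXn addSn /= -addnS.
rewrite leq_add2l; apply: leq_trans (size_poly_exp_leq _ _) _.
by rewrite -opprB size_polyN size_XsubC mul1n.
Qed.

Lemma size_cell_poly {F : fieldType} k (j : 'I_k) o :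
  (size (@cell_poly F k j o) <= (if o == None then k else k.+1))%N.
Proof.
have kE : (j + (k - 1 - j)).+1 = k.
  by case: k j => [[]//|k] j; rewrite subn1 subnKC //= -ltnS.
have s1 := @size_bernstein F j (k - 1 - j); rewrite kE in s1.
rewrite /cell_poly; case: o => [b|] /=; last by rewrite mulr1.
have s2 := @size_bernstein F b (1 - b).
rewrite subnKC ?leq_b1 // in s2.
apply: leq_trans (size_polyMleq _ _) _.
have := leq_add s1 s2; rewrite addn2; by case: (_ + _)%N.
Qed.

(** * Faces, small cubes and their Jacobian matrices *)

Section Faces.
Context {R : realType} {n p : nat}.
Implicit Type t : face n p.

Lemma face_coordP t i :
  reflect (exists j, i = face_coord t j) (val t i == None).
Proof.
have memF : (val t i == None) = (i \in free_coords (val t)) by rewrite inE.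
rewrite memF; apply: (iffP idP) => [iF|[j ->]]; last exact: enum_valP.
exists (cast_ord (eqP (valP t)) (enum_rank_in iF i)).
by rewrite /face_coord cast_ordK enum_rankK_in.
Qed.

Lemma face_coord_inj t : injective (face_coord t).
Proof. by move=> j l /enum_val_inj /cast_ord_inj. Qed.

(** The increasing enumeration of the free coordinates depends only on their
    set, not on the constant values of the other coordinates; hence parallel
    faces have the same volume form. *)
Lemma eq_face_coord t t' : free_coords (val t) = free_coords (val t') ->
  face_coord t =1 face_coord t'.
Proof.
move=> tt' j; pose x0 := face_coord t j.
by rewrite /face_coord !(enum_val_nth x0) /= tt'.
Qed.

Lemma prod_face_coord t (f : 'I_n -> R) :
  \prod_i f i = (\prod_(i | val t i != None) f i) * \prod_j f (face_coord t j).
Proof.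
rewrite (bigID (fun i => val t i == None)) mulrC; congr (_ * _).
rewrite (eq_bigl [in free_coords (val t)]) => [|i]; last by rewrite !inE.
rewrite big_enum_val (reindex (cast_ord (esym (eqP (valP t))))) //.
exists (cast_ord (eqP (valP t))) => j _; [exact: cast_ordKV | exact: cast_ordK].
Qed.

Lemma cubical_formE k (m : multi_index n k) t x (V : 'M[R]_(p, n)) :
  cubical_form m t x V =
    (\prod_i (cell_poly k (m i) (val t i)).[x 0 i]) *
    \det (colsub (face_coord t) V).
Proof.
rewrite /cubical_form /lowest_form /dx_wedge mulrA; congr (_ * _).
rewrite [X in _ * X]big_mkcond -big_split; apply: eq_bigr => i _ /=.
rewrite /cell_poly /face_value inE hornerM; congr (_ * _).
  by rewrite !hornerE.
by case: (val t i) => [[]|]; rewrite /= !hornerE.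
Qed.

Lemma face_paramE t (s : 'rV[R]_p) i :
  face_param t s 0 i =
    (face_value t i)%:R + \sum_j s 0 j * (i == face_coord t j)%:R.
Proof.
rewrite /face_param !mxE summxE; congr (_ + _).
by apply: eq_bigr => j _; rewrite !mxE.
Qed.

Lemma face_param_free t (s : 'rV[R]_p) j :
  face_param t s 0 (face_coord t j) = s 0 j.
Proof.
rewrite face_paramE (bigD1 j) //= eqxx mulr1 big1 ?addr0.
  have /eqP tj : val t (face_coord t j) == None by apply/face_coordP; exists j.
  by rewrite /face_value tj add0r.
by move=> l lj; rewrite (inj_eq (@face_coord_inj t)) eq_sym (negPf lj) mulr0.
Qed.

Lemma face_param_fixed t (s : 'rV[R]_p) i : val t i != None ->
  face_param t s 0 i = (face_value t i)%:R.
Proof.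
move=> ti; rewrite face_paramE big1 ?addr0 // => j _; case: eqP => [ij|].
  by case/face_coordP: ti; exists j.
by rewrite mulr0.
Qed.

Lemma small_cubeE k (m : multi_index n k) t (s : 'rV[R]_p) i :
  small_cube m t s 0 i = (cell_line k (m i)).[face_param t s 0 i].
Proof. by rewrite horner_cell_line mxE. Qed.

Lemma unit_cube_face_param t (s : 'rV[R]_p) :
  unit_cube s -> unit_cube (face_param t s).
Proof.
move=> s01 i; case: (boolP (val t i == None)) => [/face_coordP[j ->]|ti].
  by rewrite face_param_free.
by rewrite face_param_fixed // ler0n lern1 leq_b1.
Qed.

Lemma unit_cube_small_cube k (m : multi_index n k) t (s : 'rV[R]_p) :
  unit_cube s -> unit_cube (small_cube m t s).
Proof.
move=> /(unit_cube_face_param t) u01 i; rewrite small_cubeE horner_cell_line.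
have /andP[u0 u1] := u01 i.
have k_gt0 : 0 < k%:R :> R by rewrite ltr0n; case: (m i) => j; case: k {m}.
rewrite mulr_ge0 ?invr_ge0 ?(ltW k_gt0) ?addr_ge0 //=.
rewrite ler_pdivrMl // mulr1 (le_trans (lerD (lexx _) u1)) // natr1.
by rewrite ler_nat.
Qed.

Definition face_matrix t : 'M[R]_(p, n) :=
  \matrix_(j, i) (i == face_coord t j)%:R.

(** Right multiplication by a matrix is a finite sum of coordinate functions
    times constant vectors. *)
Lemma mulmxr_continuous (A : 'M[R]_(p, n)) :
  continuous (mulmxr A : 'rV_p -> 'rV_n).
Proof.
move=> x; apply: differentiable_continuous.
have -> : (mulmxr A : 'rV_p -> 'rV_n) =
    \sum_j (fun s : 'rV_p => s 0 j *: row j A).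
  by apply/funext => s /=; rewrite mulmx_sum_row fct_sumE.
apply: differentiable_sum => j; apply: differentiableZl.
exact: differentiable_coord.
Qed.

Lemma jacobian_affine (b : 'rV[R]_n) (A : 'M[R]_(p, n)) x :
  jacobian (fun s => b + s *m A) x = A.
Proof.
have cA := mulmxr_continuous A.
have E : (fun s => b + s *m A) = cst b + (mulmxr A : 'rV_p -> 'rV_n) by [].
rewrite /jacobian E.
have d : 'd (cst b + (mulmxr A : 'rV_p -> 'rV_n)) x =
    mulmxr A :> ('rV_p -> 'rV_n).
  rewrite diffD; [|exact: differentiable_cst|exact: linear_differentiable].
  have d0 := @diff_cst R 'rV[R]_p 'rV[R]_n b x.
  have d1 := diff_lin x cA.
  apply/funext => v.
  have e0 := congr1 (fun g => g v) d0.
  have e1 := congr1 (fun g => g v) d1.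
  exact: (etrans (congr2 +%R e0 e1) (add0r _)).
apply/matrixP => i j; rewrite mxE d /= -rowE; exact: mxE.
Qed.

Lemma jacobian_small_cube k (m : multi_index n k) t (s : 'rV[R]_p) :
  jacobian (small_cube m t) s = k%:R^-1 *: face_matrix t.
Proof.
have -> : small_cube m t =
    fun s => small_cube m t 0 + s *m (k%:R^-1 *: face_matrix t).
  apply/funext => r; apply/rowP => i.
  have f0 : face_param t (0 : 'rV[R]_p) 0 i = (face_value t i)%:R.
    by rewrite face_paramE big1 ?addr0 // => j _; rewrite mxE mul0r.
  rewrite [in RHS]mxE !small_cubeE !horner_cell_line f0 face_paramE.
  rewrite addrA mulrDr; congr (_ + _).
  rewrite -scalemxAr 2!mxE; congr (_ * _).
  by apply: eq_bigr => j _; rewrite mxE.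
exact: jacobian_affine.
Qed.

(** The form [dx] of one face, evaluated on the Jacobian matrix of a small cube
    over another face.  When the faces are not parallel, some coordinate is free
    on [t'] and constant on [t], because both have [p] free coordinates; its
    column is zero. *)
Lemma det_face_matrix t t' (c : R) :
  \det (colsub (face_coord t') (c *: face_matrix t)) =
  if free_coords (val t') == free_coords (val t) then c ^+ p else 0.
Proof.
case: eqP => [tt'|ntt'].
  rewrite -[RHS]det_scalar; congr (\det _); apply/matrixP => i j.
  rewrite !mxE (eq_face_coord _ _ tt') (inj_eq (@face_coord_inj t)) eq_sym.
  by rewrite mulr_natr.
have : ~~ (free_coords (val t') \subset free_coords (val t)).
  apply/negP => sub; apply: ntt'; apply/eqP.
  by rewrite eqEcard sub (eqP (valP t)) (eqP (valP t')) leqnn.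
case/subsetPn => i; rewrite !inE => /face_coordP[j ->] tj.
rewrite (expand_det_col _ j) big1 // => l _; rewrite !mxE.
case: eqP => [e|]; last by rewrite mulr0 mul0r.
by case/face_coordP: tj; exists l.
Qed.

End Faces.

(** * Integrals over small cubes and the theorem *)

(** Only the terms parallel to the small cube survive in the pullback, where
    they are split into a constant factor, from the coordinates that are fixed
    on the cube, and a product of polynomials in the [p] parameters. *)
Lemma integral_small_cube {R : realType} {n p k : nat}
    (a : multi_index n k -> face n p -> R) (w : diff_form R n p)
    (m : multi_index n k) (t : face n p) :
  (forall x, unit_cube x -> forall V,
     w x V = \sum_m' \sum_t' a m' t' * cubical_form m' t' x V) ->
  integral_form (small_cube m t) w =
  k%:R^-1 ^+ p * \sum_(mt : multi_index n k * face n p |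
      free_coords (val mt.2) == free_coords (val t))
    a mt.1 mt.2 * \prod_i cell_functional k (val t i == None)
      (m i, val t i == Some true) (cell_poly k (mt.1 i) (val mt.2 i)).
Proof.
move=> wE; rewrite /integral_form.
pose g (mt : multi_index n k * face n p) i : {poly R} :=
  cell_poly k (mt.1 i) (val mt.2 i) \Po cell_line k (m i).
pose P (mt : multi_index n k * face n p) :=
  free_coords (val mt.2) == free_coords (val t).
pose c mt := (if P mt then a mt.1 mt.2 * k%:R^-1 ^+ p else 0) *
  \prod_(i | val t i != None) (g mt i).[(face_value t i)%:R].
transitivity (integral_unit_cube (fun s : 'rV[R]_p =>
    \sum_mt c mt * \prod_j (g mt (face_coord t j)).[s 0 j])).
  apply: eq_integral_unit_cube => s s01.
  rewrite jacobian_small_cube wE; last exact: unit_cube_small_cube.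
  rewrite pair_big; apply: eq_bigr => mt _.
  rewrite cubical_formE det_face_matrix -/(P mt) /c.
  case: ifP => _; last by rewrite !mulr0 !mul0r.
  rewrite (prod_face_coord t) [X in _ * X = _]mulrC !mulrA; congr (_ * _ * _).
    apply: eq_bigr => i ti.
    by rewrite small_cubeE face_param_fixed // horner_comp.
  apply: eq_bigr => j _.
  by rewrite small_cubeE face_param_free horner_comp.
rewrite integral_unit_cube_sum mulr_sumr [RHS]big_mkcond.
apply: eq_bigr => mt _; rewrite -/(P mt) /c.
case: ifP => _; last by rewrite !mul0r.
rewrite [in RHS](prod_face_coord t) [RHS]mulrCA -!mulrA.
congr (_ * (_ * (_ * _))).
  by apply: eq_bigr => i ti; rewrite /cell_functional (negPf ti).
apply: eq_bigr => j _.
have -> : val t (face_coord t j) == None by apply/face_coordP; exists j.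
by [].
Qed.

Theorem theorem3p6 (R : realType) (n p k : nat) (hn : (1 <= n)%N)
    (hp : (p <= n)%N) (hk : (1 <= k)%N) (w : diff_form R n p)
    (hw : cubical_space k w)
    (hint : forall u : 'rV[R]_p -> 'rV[R]_n,
        small_cubes k u -> integral_form u w = 0) :
  forall x : 'rV[R]_n, unit_cube x -> forall V : 'M[R]_(p, n), w x V = 0.
Proof.
case: hw => a wE x x01 V; rewrite wE // pair_big.
rewrite (partition_big (fun mt => free_coords (val mt.2)) xpredT) //=.
apply: big1 => F _.
have [cF|nF] := boolP (#|F| == p); last first.
  by apply: big_pred0 => mt; apply: contraNF nF => /eqP <-; exact: (valP mt.2).
(* [q] chooses, for each coordinate, one functional; [T q] and the first
   components of [q] form the small cube parallel to [F] over which integration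
   is, up to the factor [k ^- p], the product of these functionals. *)
pose tF (q : {ffun 'I_n -> 'I_k * bool}) : {ffun 'I_n -> option bool} :=
  [ffun i => if i \in F then None else Some (q i).2].
have freeE q : free_coords (tF q) = F.
  by apply/setP => i; rewrite inE ffunE; case: ifP.
have faceP q : #|free_coords (tF q)| == p by rewrite freeE.
pose T q : face n p :=
  exist (fun t => is_true (#|free_coords t| == p)) (tF q) (faceP q).
pose q0 : {ffun 'I_n -> 'I_k * bool} := [ffun => (Ordinal hk, false)].
(* All the terms share the factor [dx_F V], computed here on the face [T q0]. *)
under eq_bigr => mt /eqP mtF.
  rewrite cubical_formE mulrA.
  have -> : colsub (face_coord mt.2) V = colsub (face_coord (T q0)) V.
    apply/matrixP => i j; rewrite !mxE (eq_face_coord _ (T q0)) //.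
    by rewrite mtF freeE.
  over.
rewrite -mulr_suml.
rewrite (tensor_unisolvence _ _ _ (fun i => if i \in F then k else k.+1)
  (fun i => cell_functional k (i \in F))
  (fun mt : multi_index n k * face n p => free_coords (val mt.2) == F)
  (fun mt => a mt.1 mt.2)
  (fun mt i => cell_poly k (mt.1 i) (val mt.2 i))) ?mul0r //.
- move=> i r; exact: cell_functional_inj.
- move=> mt i /eqP <-; rewrite inE; exact: size_cell_poly.
move=> q.
have := integral_small_cube a w [ffun i => (q i).1] (T q) wE.
rewrite hint; last by exists [ffun i => (q i).1], (T q).
move/esym/eqP; rewrite mulf_eq0 expf_eq0 invr_eq0 pnatr_eq0.
rewrite -[k == 0%N]negbK -lt0n hk andbF /=.
rewrite freeE => /eqP sum0; rewrite -[RHS]sum0 /=.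
apply: eq_big => [//|mt _]; congr (_ * _); apply: eq_bigr => i _.
rewrite !ffunE /cell_functional; case: (i \in F) => //=.
by case: (q i) => j [].
Qed.
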